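(* Let $\{X_{ij} : j\ge i\ge 1\}$ be a collection of i.i.d. real random variables with $\mathbb{E}X_{12}=m$ and $\mathbb{E}X_{12}^2<\infty$, and let $\mathbf{M}_n$ be the associated $n\times n$ symmetric Markov matrix. Then, with probability 1, $\hat\mu(\mathbf{M}_n/n)$ converges weakly to $\delta_{-m}$ as $n\to\infty$.
   Context: Markov matrix: put $X_{ji}=X_{ij}$ for $j>i\ge1$, $\mathbf{X}_n=[X_{ij}]_{1\le i,j\le n}$, $\mathbf{D}_n=\mathrm{diag}\big(\sum_{j=1}^nX_{ij}\big)_{1\le i\le n}$ and $\mathbf{M}_n=\mathbf{X}_n-\mathbf{D}_n$; thus each row of $\mathbf{M}_n$ sums to zero (and the values $X_{ii}$ are irrelevant). For a symmetric real $n\times n$ matrix $\mathbf{A}$ with eigenvalues $\lambda_1(\mathbf{A})\ge\dots\ge\lambda_n(\mathbf{A})$, the spectral measure is $\hat\mu(\mathbf{A})=\frac1n\sum_{j=1}^n\delta_{\lambda_j(\mathbf{A})}$. $\delta_{-m}$ is the unit mass at $-m$. *)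

(* Defs.v *)
From HB Require Import structures.
From mathcomp Require Import all_boot all_order all_algebra finmap.
From mathcomp Require Import spectral sesquilinear.
From mathcomp Require Import complex.
From mathcomp Require Import all_classical all_reals all_analysis.

Set Implicit Arguments.
Unset Strict Implicit.
Unset Printing Implicit Defensive.

Import Order.TTheory GRing.Theory Num.Theory.
Import numFieldNormedType.Exports.

Local Open Scope classical_set_scope.
Local Open Scope ring_scope.

Definition mutually_independent d (T : measurableType d) (R : realType)
    (P : probability T R) (I : choiceType) (D : set I)
    (X : I -> {RV P >-> R}) : Prop :=
  forall (J : {fset I}) (B : I -> set R),
    [set` J] `<=` D -> (forall i, measurable (B i)) ->
    P (\bigcap_(i in [set` J]) (X i @^-1` B i)) =
    (\prod_(i <- J) P (X i @^-1` B i))%E.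

Definition identically_distributed d (T : measurableType d) (R : realType)
    (P : probability T R) (I : Type) (D : set I)
    (X : I -> {RV P >-> R}) : Prop :=
  forall i j, D i -> D j ->
  forall B : set R, measurable B -> distribution P (X i) B = distribution P (X j) B.

Definition iid d (T : measurableType d) (R : realType) (P : probability T R)
    (I : choiceType) (D : set I) (X : I -> {RV P >-> R}) : Prop :=
  mutually_independent D X /\ identically_distributed D X.

Definition weak_cvg (R : realType)
    (mu : nat -> {measure set R -> \bar R})
    (nu : {measure set R -> \bar R}) : Prop :=
  forall f : R -> R, continuous f -> bounded_fun f ->
    (\int[mu n]_x (f x)%:E)%E @[n --> \oo] --> (\int[nu]_x (f x)%:E)%E.

Section spectral_measure.
Context {R : realType} {n : nat}.
Implicit Types (A : 'M[R]_n) (s : seq R).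

Definition is_ordered_spectrum A s : Prop :=
  sorted >=%R s /\ char_poly A = \prod_(x <- s) ('X - x%:P).

(* Only meaningful for matrices whose characteristic polynomial splits over R,
   in particular symmetric ones: see [eigenvals_symmetric]. *)
Definition eigenvals A : seq R := xget [::] [set s | is_ordered_spectrum A s].

Definition spectral_measure A : {measure set R -> \bar R} :=
  mscale (n%:R^-1)%:nng (msum (fun j => \d_((eigenvals A)`_j)) n).

Lemma is_ordered_spectrum_uniq A s t :
  is_ordered_spectrum A s -> is_ordered_spectrum A t -> s = t.
Proof.
move=> [ss es] [st et]; apply: (sorted_eq ge_trans ge_anti ss st).
by apply/prod_XsubC_eq; rewrite -es et.
Qed.

Lemma size_ordered_spectrum A s : is_ordered_spectrum A s -> size s = n.
Proof.
by move=> [_ /(congr1 (size \o polyseq))] /=;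
  rewrite size_char_poly size_prod_XsubC => -[].
Qed.

Lemma eigenvals_symmetric A : A^T = A -> is_ordered_spectrum A (eigenvals A).
Proof.
move=> symA; suff [s sP] : exists s, is_ordered_spectrum A s.
  exact: (xgetPex [::] (ex_intro _ s sP)).
pose f : {rmorphism R -> R[i]%C} := real_complex R.
pose B := map_mx f A.
have hB : B \is hermsymmx.
  apply/is_hermitianmxP; rewrite expr0 scale1r; apply/matrixP => i j.
  rewrite !mxE -{1}symA mxE; apply/esym/CrealP.
  by apply/complex_realP; exists (A j i).
have Dreal := hermitian_spectral_diag_real hB.
have /orthomx_spectralP := hermitian_normalmx hB.
have := spectral_unit B; set Q := spectralmx B; set D := spectral_diag B.
move=> Qu BE.
pose l (i : 'I_n) : R := complex.Re (D ord0 i).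
have DE i : D ord0 i = f (l i).
  by have /mxOverP/(_ ord0 i)/complex_realP[k] := Dreal; rewrite /l => ->.
pose s := sort >=%R [seq l i | i <- enum 'I_n].
exists s; split; first by apply: sort_sorted => x y; exact: ge_total.
have -> : \prod_(x <- s) ('X - x%:P) = \prod_(i < n) ('X - (l i)%:P).
  rewrite (perm_big [seq l i | i <- enum 'I_n]); last by rewrite perm_sort.
  by rewrite big_map big_enum.
apply: (@map_poly_inj _ _ f); rewrite map_char_poly rmorph_prod.
rewrite -/B; transitivity (char_poly (diag_mx D)).
  have QB : Q *m B = diag_mx D *m Q by rewrite BE !mulmxA mulmxV// mul1mx.
  pose Qp := map_mx polyC Q.
  have QBp : Qp *m char_poly_mx B = char_poly_mx (diag_mx D) *m Qp.
    rewrite /char_poly_mx mulmxBr mulmxBl -!map_mxM QB.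
    by rewrite mul_mx_scalar mul_scalar_mx.
  have /(congr1 determinant) := QBp; rewrite !det_mulmx mulrC => /mulIf; apply.
  by rewrite det_map_mx polyC_eq0 -unitfE -unitmxE.
rewrite char_poly_trig ?diag_mx_is_trig//; apply: eq_bigr => i _.
by rewrite mxE eqxx mulr1n DE; exact: esym (map_polyXsubC f (l i)).
Qed.

End spectral_measure.

Section markov_matrix.
Context d (T : measurableType d) (R : realType) (P : probability T R).
Variable X : nat -> nat -> {RV P >-> R}.

(* Indices start at 0; only the entries [X i j] with [i <= j] are used. *)
Definition sym_mx (n : nat) (w : T) : 'M[R]_n :=
  \matrix_(i, j) X (minn i j) (maxn i j) w.

Definition row_sum_mx (n : nat) (w : T) : 'M[R]_n :=
  diag_mx (\row_i \sum_j sym_mx n w i j).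

Definition markov_mx (n : nat) (w : T) : 'M[R]_n :=
  sym_mx n w - row_sum_mx n w.

Lemma markov_mx_sym n w : (markov_mx n w)^T = markov_mx n w.
Proof.
rewrite /markov_mx linearB /= tr_diag_mx; congr (_ - _).
by apply/matrixP => i j; rewrite !mxE minnC maxnC.
Qed.

End markov_matrix.

(* Main.v *)
(* Write Y = X - m. By symmetry the eigenvalues l_j of A = M_n / n satisfy
   sum_j (l_j + m)^2 = tr (A + m)^2, and the mean of these squares is, up to
   constants, at most S_n / n^3 + W_n / n^3 + O(1 / n), where
   S_n = sum_(i <> j) Y_ij^2 and W_n is the sum of Y_ij Y_ik over distinct i, j, k.
   Since E S_n = O(n^2), the series of S_n / n^4 converges almost surely, so
   S_n / n^3 -> 0 because S_n is nondecreasing. Products Y_ij Y_ik belonging to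
   different pairs of edges are orthogonal by independence, so E W_n^2 = O(n^3)
   and (W_n / n^3)^2 is almost surely summable. Finally a continuous bounded f satisfies
   |f x - f (-m)| <= e + C (x + m)^2. *)
Require Import Defs.
From mathcomp Require Import all_boot all_order all_algebra finmap.
From mathcomp Require Import all_classical all_reals all_analysis.
From mathcomp Require Import measurable_realfun.
From mathcomp Require Import ring lra zify.

Import Order.TTheory GRing.Theory Num.Theory.
Import numFieldNormedType.Exports.

Local Open Scope classical_set_scope.
Local Open Scope ring_scope.

Set Implicit Arguments.
Unset Strict Implicit.

(** * Products of independent random variables *)

Section independence.
Context d d' (T : measurableType d) (U : measurableType d') (R : realType).

Import HBNNSimple.

(** The factorization assumed for indicators extends to simple functions by linearity, then to
    nonnegative [g] by monotone convergence along simple approximations. In the use below, [h] is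
    the product of the other factors and [X] a variable independent of them. *)
Lemma integralM_of_indic (mu : {measure set T -> \bar R})
    (h : T -> R) (X : T -> U) (g : U -> R) :
  measurable_fun setT h -> (forall w, 0 <= h w) -> measurable_fun setT X ->
  (\int[mu]_w (h w)%:E < +oo)%E ->
  (forall B : set U, measurable B ->
    (\int[mu]_w (h w * \1_B (X w))%:E = \int[mu]_w (h w)%:E * mu (X @^-1` B))%E) ->
  measurable_fun setT g -> (forall x, 0 <= g x) ->
  (\int[mu]_w (h w * g (X w))%:E =
   \int[mu]_w (h w)%:E * \int[mu]_w (g (X w))%:E)%E.
Proof.
move=> mh h0 mX hoo hX mg g0.
have mgE : measurable_fun setT (EFin \o g) by exact/measurable_EFinP.
pose phi := nnsfun_approx measurableT mgE.
have phi_cvg x : (phi n x)%:E @[n --> \oo] --> (g x)%:E.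
  apply: (cvg_nnsfun_approx _ mgE) => //= y _; by rewrite lee_fin.
have phi_nd x n n' : (n <= n')%N -> phi n x <= phi n' x.
  by move=> nn'; apply/lefP/nd_nnsfun_approx.
have mphiX n : measurable_fun setT (fun w => phi n (X w)).
  exact: measurableT_comp.
have simple n : (\int[mu]_w (h w * phi n (X w))%:E =
                 \int[mu]_w (h w)%:E * \int[mu]_w (phi n (X w))%:E)%E.
  have mind r : measurable (phi n @^-1` [set r]).
    by rewrite -[X in measurable X]setTI; exact: measurable_funP.
  have m1 r : measurable_fun setT (fun w => \1_(phi n @^-1` [set r]) (X w) : R).
    exact: measurableT_comp.
  have r0 r : r \in range (phi n) -> 0 <= r.
    by rewrite inE => -[t _ <-].
  have E1 (k : T -> R) : measurable_fun setT k -> (forall w, 0 <= k w) ->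
      (\int[mu]_w (k w * phi n (X w))%:E =
       \sum_(r \in range (phi n)) r%:E *
          \int[mu]_w (k w * \1_(phi n @^-1` [set r]) (X w))%:E)%E.
    move=> mk k0.
    (* Exchanging sum and integral asks for nonnegative terms at every real [r], also outside the
       range of [phi n]; [|r|] ensures this and equals [r] on the range. *)
    transitivity (\int[mu]_w (\sum_(r \in range (phi n))
      `|r|%:E * (k w * \1_(phi n @^-1` [set r]) (X w))%:E)%E)%E.
      apply: eq_integral => w _; rewrite fimfunE EFinM -fsumEFin//.
      rewrite ge0_mule_fsumr; last first.
        by move=> r; exact: nnfun_muleindic_ge0.
      apply: eq_fsbigr => r rr.
      by rewrite ger0_norm ?r0// !EFinM muleCA.
    rewrite ge0_integral_fsum//; last 2 first.
    - move=> r; apply/measurable_EFinP => /=; apply: measurable_funM => //.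
      exact: measurable_funM.
    - by move=> r w _; rewrite lee_fin !mulr_ge0.
    apply: eq_fsbigr => r rr; rewrite ger0_norm ?r0//.
    rewrite ge0_integralZl ?lee_fin ?r0//.
    - by apply/measurable_EFinP; exact: measurable_funM.
    - by move=> w _; rewrite lee_fin mulr_ge0.
  rewrite E1//.
  have := E1 (cst 1) (@measurable_cst _ _ _ _ _ _) (fun=> ler01).
  under eq_integral do rewrite mul1r.
  move=> ->.
  rewrite ge0_mule_fsumr; last first.
    move=> r; case: (boolP (r \in range (phi n))) => [/r0 r_ge0|rr].
      by rewrite mule_ge0// integral_ge0// => w _; rewrite lee_fin mul1r.
    rewrite preimage10 ?indic0; last by move/negP: rr; rewrite inE.
    under eq_integral do rewrite mulr0.
    by rewrite integral0 mule0.
  apply: eq_fsbigr => r rr; rewrite hX// muleCA; congr (_ * (_ * _))%E.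
  under eq_integral do rewrite mul1r.
  have mXr := mX measurableT _ (mind r); rewrite setTI in mXr.
  by rewrite integral_indic// setIT.
have lim1 : (\int[mu]_w (g (X w))%:E = limn (fun n => \int[mu]_w (phi n (X w))%:E))%E.
  rewrite -monotone_convergence//.
  - by apply: eq_integral => w _; apply/esym/cvg_lim => //; exact: phi_cvg.
  - by move=> n; exact/measurable_EFinP.
  - by move=> n w _; rewrite lee_fin.
  - by move=> w _ n n' nn'; rewrite lee_fin phi_nd.
have lim2 : (\int[mu]_w (h w * g (X w))%:E =
             limn (fun n => \int[mu]_w (h w * phi n (X w))%:E))%E.
  rewrite -monotone_convergence//.
  - apply: eq_integral => w _; apply/esym/cvg_lim => //.
    under eq_fun do rewrite EFinM.
    rewrite EFinM.
    by apply: cvgeZl => //; exact: phi_cvg.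
  - by move=> n; apply/measurable_EFinP; exact: measurable_funM.
  - by move=> n w _; rewrite lee_fin mulr_ge0.
  - by move=> w _ n n' nn'; rewrite lee_fin ler_wpM2l// phi_nd.
(* Finiteness of the integral of [h] allows the constant factor to be taken out of the limit. *)
rewrite lim1 lim2; under eq_fun do rewrite simple.
apply/cvg_lim => //; apply: cvgeZl.
- by rewrite ge0_fin_numE// integral_ge0// => w _; rewrite lee_fin.
- apply: ereal_nondecreasing_is_cvgn => n n' nn'.
  apply: ge0_le_integral => //.
  + by move=> w _; rewrite lee_fin.
  + exact/measurable_EFinP.
  + exact/measurable_EFinP.
  + by move=> w _; rewrite lee_fin phi_nd.
Qed.
End independence.

Section independent_family.
Context d (T : measurableType d) (R : realType) (P : probability T R).
Context (I : choiceType) (D : set I) (X : I -> {RV P >-> R}).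
Hypothesis indX : mutually_independent D X.

Lemma probability_bigcap_seq (t : seq I) (B : I -> set R) :
  uniq t -> {in t, forall i, D i} -> (forall i, measurable (B i)) ->
  (P (\bigcap_(i in [set` t]) (X i @^-1` B i)) =
   \prod_(i <- t) P (X i @^-1` B i))%E.
Proof.
move=> ut tD mB.
have tE : [set` [fset i in t]%fset] = [set` t].
  by apply/seteqP; split => i /=; rewrite in_fset.
rewrite -tE indX//; last by move=> i; rewrite tE /= => /tD.
apply: perm_big; apply: uniq_perm => // i; by rewrite in_fset.
Qed.

(** Mixing functions (over [s]) with indicators (over [t]) makes the induction on [s] work. To treat
    a new factor [g a], only indicators of [X a] need to be tested, and such an indicator moves [a]
    into [t], where the induction hypothesis applies. With [s] empty, the claim is independence of
    events. *)
Lemma expectation_prod_indic (s t : seq I) (g : I -> R -> R) (B : I -> set R) :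
  uniq (s ++ t) -> {in s ++ t, forall i, D i} ->
  (forall i, measurable (B i)) ->
  (forall i, measurable_fun setT (g i)) -> (forall i x, 0 <= g i x) ->
  {in s, forall i, (\int[P]_w (g i (X i w))%:E < +oo)%E} ->
  (\int[P]_w ((\prod_(i <- s) g i (X i w)) * \prod_(i <- t) \1_(B i) (X i w))%:E =
   (\prod_(i <- s) \int[P]_w (g i (X i w))%:E) * \prod_(i <- t) P (X i @^-1` B i))%E.
Proof.
move=> + + mB mg g0.
have ig0 i : (0 <= \int[P]_w (g i (X i w))%:E)%E.
  by apply: integral_ge0 => w _; rewrite lee_fin.
elim: s t B mB => [|a s IH] t B mB ust stD goo.
  rewrite big_nil mul1e -probability_bigcap_seq//.
  have mcap : measurable (\bigcap_(i in [set` t]) (X i @^-1` B i)).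
    by apply: fin_bigcap_measurable => // i _; exact: measurable_funPTI.
  rewrite -[X in P X]setIT -integral_indic//; apply: eq_integral => w _.
  rewrite big_nil mul1r; congr EFin.
  rewrite indicE; case: (boolP (w \in _)) => [|].
    rewrite inE => wcap; rewrite big_seq big1// => i it.
    by rewrite indicE mem_set//; exact: wcap.
  rewrite notin_setE => wcap.
  have [/allP wt|/allPn[i it iB]] := boolP (all (fun i => X i w \in B i) t).
    by exfalso; apply: wcap => i /= /wt; rewrite inE.
  by rewrite (big_rem i)//= indicE (negbTE iB) mul0r.
pose h w := (\prod_(i <- s) g i (X i w)) * \prod_(i <- t) \1_(B i) (X i w).
have h0 w : 0 <= h w by rewrite mulr_ge0// prodr_ge0.
have mh : measurable_fun setT h.
  apply: measurable_funM; apply: measurable_prod => i _.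
    exact: measurableT_comp.
  exact: measurableT_comp.
have at_ : a \notin t by move: ust; rewrite /= mem_cat negb_or => /andP[/andP[]].
have ust' : uniq (s ++ t) by move: ust => /= /andP[].
have goo' : {in s, forall i, (\int[P]_w (g i (X i w))%:E < +oo)%E}.
  by move=> i is_; apply: goo; rewrite inE is_ orbT.
have hE : (\int[P]_w (h w)%:E =
    (\prod_(i <- s) \int[P]_w (g i (X i w))%:E) *
     \prod_(i <- t) P (X i @^-1` B i))%E.
  by apply: IH => // i ist; apply: stD; rewrite inE ist orbT.
transitivity (\int[P]_w (h w * g a (X a w))%:E)%E.
  by apply: eq_integral => w _; rewrite /h big_cons -mulrA mulrC.
rewrite (@integralM_of_indic _ _ _ R)//.
- by rewrite hE big_cons muleC muleA.
- rewrite hE -ge0_fin_numE; last by rewrite mule_ge0// prode_ge0.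
  rewrite fin_numM//; last first.
    by apply: prode_fin_num => i _; rewrite fin_num_measure//; exact: measurable_funPTI.
  rewrite big_seq; apply: prode_fin_num => i is_; by rewrite ge0_fin_numE// goo'.
- move=> A mA; rewrite hE.
  (* Since [a] is not in [t], setting the event of [a] to [A] leaves the other indicators
     unchanged. *)
  pose B' i := if i == a then A else B i.
  have B'E i : i \in t -> B' i = B i.
    by rewrite /B'; case: eqVneq => // -> /(negP at_).
  transitivity (\int[P]_w ((\prod_(i <- s) g i (X i w)) *
      \prod_(i <- a :: t) \1_(B' i) (X i w))%:E)%E.
    apply: eq_integral => w _; rewrite big_cons {1}/B' eqxx [in RHS]mulrCA mulrC.
    congr (_ * (_ * _))%:E.
    by apply: eq_big_seq => i it; rewrite B'E.
  rewrite IH//.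
  + rewrite big_cons {1}/B' eqxx muleCA muleC; congr (_ * _ * _)%E.
    by apply: eq_big_seq => i it; rewrite B'E.
  + by move=> i; rewrite /B'; case: ifP.
  + by rewrite (perm_uniq (permEl (perm_catCA s [:: a] t))).
  + by move=> i; rewrite (perm_mem (permEl (perm_catCA s [:: a] t))); exact: stD.
Qed.

End independent_family.

Section independent_integrable_family.
Context d (T : measurableType d) (R : realType) (P : probability T R).
Context (I : choiceType) (D : set I) (X : I -> {RV P >-> R}).
Hypothesis indX : mutually_independent D X.
Implicit Types (s u : seq I) (g : I -> R -> R).

Lemma ge0_expectation_prod s g : uniq s -> {in s, forall i, D i} ->
  (forall i, measurable_fun setT (g i)) -> (forall i x, 0 <= g i x) ->
  {in s, forall i, P.-integrable setT (fun w => (g i (X i w))%:E)} ->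
  (\int[P]_w (\prod_(i <- s) g i (X i w))%:E =
   (\prod_(i <- s) \int[P]_w g i (X i w))%:E)%E.
Proof.
move=> us sD mg g0 ig.
have /= := @expectation_prod_indic _ _ _ _ _ _ _ indX s [::] g (fun=> setT).
rewrite cats0 big_nil mule1 => /(_ us sD) E.
transitivity (\int[P]_w ((\prod_(i <- s) g i (X i w)) *
    \prod_(i <- [::]) \1_setT (X i w))%:E)%E.
  by apply: eq_integral => w _; rewrite big_nil mulr1.
rewrite E//.
- rewrite (big_morph EFin EFinM erefl); apply: eq_big_seq => i si.
  by rewrite [RHS]fineK// integrable_fin_num// ig.
- by move=> i si; rewrite integrable_lty// ig.
Qed.

(** The nonnegative case applied to the absolute values gives a finite integral. *)
Lemma integrable_prod s g : uniq s -> {in s, forall i, D i} ->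
  (forall i, measurable_fun setT (g i)) ->
  {in s, forall i, P.-integrable setT (fun w => (g i (X i w))%:E)} ->
  P.-integrable setT (fun w => (\prod_(i <- s) g i (X i w))%:E).
Proof.
move=> us sD mg ig; apply/integrableP; split.
  apply/measurable_EFinP; apply: measurable_prod => i _.
  exact: measurableT_comp.
under eq_integral do rewrite abse_EFin normr_prod.
rewrite (@ge0_expectation_prod s (fun i x => `|g i x|)) ?ltry//.
- by move=> i; exact: measurableT_comp.
- by move=> i si; exact: (integrable_norm (ig i si)).
Qed.

(** Signs are removed one factor at a time: [g = |g| - (|g| - g)] is a difference of two nonnegative
    integrable functions, and both sides are linear in each factor. *)
Lemma expectation_prod s g : uniq s -> {in s, forall i, D i} ->
  (forall i, measurable_fun setT (g i)) ->
  {in s, forall i, P.-integrable setT (fun w => (g i (X i w))%:E)} ->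
  (\int[P]_w (\prod_(i <- s) g i (X i w)) =
   \prod_(i <- s) \int[P]_w g i (X i w))%R.
Proof.
move=> us sD mg ig.
(* Induction on the list [s1] of indices whose factor may still change sign; the factors indexed by
   [u] are already nonnegative. *)
suff gen s1 u g1 : perm_eq (s1 ++ u) s ->
    (forall i, measurable_fun setT (g1 i)) ->
    {in s, forall i, P.-integrable setT (fun w => (g1 i (X i w))%:E)} ->
    {in u, forall i x, 0 <= g1 i x} ->
    (\int[P]_w (\prod_(i <- s) g1 i (X i w)) =
     \prod_(i <- s) \int[P]_w g1 i (X i w))%R.
  by apply: (gen s [::]) => //; rewrite cats0.
elim: s1 u g1 => [|a s1 IH] u g1 su mg1 ig1 g10.
  rewrite /= in su.
  transitivity (\int[P]_w (\prod_(i <- s) `|g1 i (X i w)|))%R.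
    apply: eq_Rintegral => w _; apply: eq_big_seq => i.
    by rewrite -(perm_mem su) => iu; rewrite ger0_norm// g10.
  rewrite [LHS]/Rintegral (@ge0_expectation_prod s (fun i x => `|g1 i x|))//=.
  - apply: eq_big_seq => i; rewrite -(perm_mem su) => iu.
    by apply: eq_Rintegral => w _; rewrite ger0_norm// g10.
  - by move=> i; exact: measurableT_comp.
  - by move=> i si; exact: (integrable_norm (ig1 i si)).
have sa : perm_eq s (a :: (s1 ++ u)) by rewrite perm_sym.
have asu : a \notin s1 ++ u.
  by move: us; rewrite (perm_uniq sa) /= => /andP[].
have su' : perm_eq (s1 ++ a :: u) s.
  by apply: perm_trans su; exact: (permEl (perm_catCA s1 [:: a] u)).
have as_ : a \in s by rewrite (perm_mem sa) inE eqxx.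
(* For nonnegative [f], replacing the factor at [a] by [f] moves [a] from [s1] to [u]. *)
pose upd (f : R -> R) i : R -> R := if i == a then f else g1 i.
have updE f i : i \in s1 ++ u -> upd f i = g1 i.
  by rewrite /upd; case: eqVneq => // -> /(negP asu).
have IHf f : measurable_fun setT f ->
    P.-integrable setT (fun w => (f (X a w))%:E) -> (forall x, 0 <= f x) ->
    P.-integrable setT (fun w => (f (X a w) * \prod_(i <- s1 ++ u) g1 i (X i w))%:E) /\
    (\int[P]_w (f (X a w) * \prod_(i <- s1 ++ u) g1 i (X i w)) =
    \int[P]_w f (X a w) * \prod_(i <- s1 ++ u) \int[P]_w g1 i (X i w))%R.
  move=> mf if_ f0.
  have mu i : measurable_fun setT (upd f i) by rewrite /upd; case: ifP.
  have iu : {in s, forall i, P.-integrable setT (fun w => (upd f i (X i w))%:E)}.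
    by move=> i si; rewrite /upd; case: eqVneq => [->|_] //; exact: ig1.
  have prodE w : \prod_(i <- s) upd f i (X i w) =
                 f (X a w) * \prod_(i <- s1 ++ u) g1 i (X i w).
    rewrite (perm_big _ sa) big_cons {1}/upd eqxx; congr (_ * _).
    by apply: eq_big_seq => i /updE ->.
  split.
    have := integrable_prod us sD mu iu.
    by under eq_fun do rewrite prodE.
  under eq_Rintegral do rewrite -prodE.
  rewrite (IH (a :: u))//.
    rewrite (perm_big _ sa) big_cons {1}/upd eqxx; congr (_ * _).
    by apply: eq_big_seq => i /updE ->.
  move=> i; rewrite inE /upd; case: eqVneq => //= _; exact: g10.
have ia := ig1 a as_.
have mn : measurable_fun setT (fun x => `|g1 a x|) by exact: measurableT_comp.
have [ip Ep] := IHf (fun x => `|g1 a x|) mn (integrable_norm ia) (fun x => normr_ge0 _).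
have mq : measurable_fun setT (fun x => `|g1 a x| - g1 a x).
  by apply: measurable_funB => //; exact: measurableT_comp.
have iq : P.-integrable setT (fun w => (`|g1 a (X a w)| - g1 a (X a w))%:E).
  under eq_fun do rewrite EFinB.
  by apply: integrableB => //; exact: (integrable_norm ia).
have q0 x : 0 <= `|g1 a x| - g1 a x by rewrite subr_ge0 ler_norm.
have [iq' Eq] := IHf _ mq iq q0.
rewrite (perm_big _ sa) big_cons /=.
have -> : (\int[P]_w g1 a (X a w) = \int[P]_w `|g1 a (X a w)| -
    \int[P]_w (`|g1 a (X a w)| - g1 a (X a w)))%R.
  rewrite -RintegralB//; last exact: (integrable_norm ia).
  by apply: eq_Rintegral => w _; rewrite subKr.
rewrite mulrBl -Ep -Eq -RintegralB//; apply: eq_Rintegral => w _.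
by rewrite (perm_big _ sa) big_cons /= -mulrBl subKr.
Qed.

End independent_integrable_family.

(** * Eigenvalues and the Frobenius norm *)

Section spectrum.
Context (R : realType) (n : nat).
Implicit Types (A : 'M[R]_n) (s : seq R).

Lemma size_char_poly_roots A s :
  char_poly A = \prod_(x <- s) ('X - x%:P) -> size s = n.
Proof.
by move=> /(congr1 (size \o polyseq)) /=; rewrite size_char_poly size_prod_XsubC => -[].
Qed.

(** Both sides are, up to sign, the coefficient of degree [n - 1] of the characteristic polynomial;
    [n = 0] is separate because that coefficient does not exist. *)
Lemma trace_prod_XsubC A s :
  char_poly A = \prod_(x <- s) ('X - x%:P) -> \tr A = \sum_(x <- s) x.
Proof.
move=> As; have sn := size_char_poly_roots As.
case: (posnP n) => [n0|n_gt0].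
  have -> : s = [::] by apply: size0nil; rewrite sn.
  by rewrite big_nil /mxtrace big1// => i; have := ltn_ord i; rewrite {2}n0.
apply: oppr_inj; rewrite -char_poly_trace// As -sn coefPn_prod_XsubC//.
by rewrite sn -lt0n.
Qed.

(* det(X^2 - A^2) = det(X - A) det(X + A), and p |-> p(X^2) is injective. *)
Lemma char_poly_sqr A s : char_poly A = \prod_(x <- s) ('X - x%:P) ->
  char_poly (A *m A) = \prod_(x <- s) ('X - (x ^+ 2)%:P).
Proof.
move=> As; have sn := size_char_poly_roots As.
pose pA := map_mx polyC A.
have comp_char (B : 'M[R]_n) q : char_poly B \Po q = \det (q%:M - map_mx polyC B).
  rewrite /char_poly -(det_map_mx (comp_poly q)); congr (\det _).
  apply/matrixP => i j; rewrite !mxE rmorphB /= comp_polyC.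
  by rewrite rmorphMn /= comp_polyX.
(* Substituting [-X] into the factored characteristic polynomial produces the sign [(-1)^n] on both
   sides, which cancels. *)
have plusA : \det ('X%:M + pA) = \prod_(x <- s) ('X + x%:P).
  have : char_poly A \Po (- 'X) = (-1) ^+ n * \det ('X%:M + pA).
    rewrite comp_char -detZ scaleN1r opprD; congr (\det (_ - _)).
    by apply/matrixP => i j; rewrite !mxE mulNrn.
  rewrite As rmorph_prod /=.
  under eq_bigr do rewrite rmorphB /= comp_polyX comp_polyC -opprD.
  have -> : \prod_(x <- s) - ('X + x%:P) = (-1) ^+ n * \prod_(x <- s) ('X + x%:P).
    rewrite -sn; elim: (s) => [|x s' IH]; first by rewrite !big_nil expr0 mul1r.
    by rewrite !big_cons IH /= exprS; ring.
  by move=> /(mulfI _) ->//; rewrite signr_eq0.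
have : char_poly (A *m A) \Po 'X^2 = (\prod_(x <- s) ('X - (x ^+ 2)%:P)) \Po 'X^2.
  rewrite comp_char rmorph_prod /=.
  transitivity (\det (char_poly_mx A *m ('X%:M + pA))).
    congr (\det _); rewrite mulmxDr !mulmxBl map_mxM /= -/pA.
    by rewrite -scalar_mxM -expr2 scalar_mxC addrA subrK.
  rewrite det_mulmx -/(char_poly A) As plusA -big_split; apply: eq_bigr => x _ /=.
  rewrite rmorphB /= comp_polyX comp_polyC rmorphXn /=. ring.
move=> /eqP; rewrite -subr_eq0 -rmorphB /= comp_poly_eq0 ?size_polyXn//.
by rewrite subr_eq0 => /eqP.
Qed.

(** Both sides equal [tr (A^2) + 2 c tr A + c^2 n]. The right side is the squared Frobenius norm of
    [A + c I], and symmetry turns [tr (A^2)] into the sum of squared entries. *)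
Lemma spectrum_sqr_dist A s (c : R) : A^T = A ->
  char_poly A = \prod_(x <- s) ('X - x%:P) ->
  \sum_(x <- s) (x + c) ^+ 2 = \sum_i \sum_j (A i j + c *+ (i == j)) ^+ 2.
Proof.
move=> symA As; have sn := size_char_poly_roots As.
have trA := trace_prod_XsubC As.
have trA2 : \tr (A *m A) = \sum_(x <- s) x ^+ 2.
  rewrite (@trace_prod_XsubC _ [seq x ^+ 2 | x <- s]) ?big_map//.
  exact: char_poly_sqr.
transitivity (\tr (A *m A) + 2 * c * \tr A + c ^+ 2 * n%:R).
  rewrite trA trA2 mulr_sumr -sn -sum1_size natr_sum mulr_sumr -!big_split /=.
  by apply: eq_bigr => x _; ring.
have -> : \tr (A *m A) = \sum_i \sum_j A i j ^+ 2.
  apply: eq_bigr => i _; rewrite mxE; apply: eq_bigr => j _.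
  by rewrite -{2}symA mxE expr2.
have -> : c ^+ 2 * n%:R = \sum_(i < n) c ^+ 2.
  by rewrite sumr_const card_ord mulr_natr.
rewrite /mxtrace mulr_sumr -!big_split /=; apply: eq_bigr => i _.
rewrite (bigD1 i)//= [in RHS](bigD1 i)//= eqxx mulr1n.
rewrite [in RHS](eq_bigr (fun j => A i j ^+ 2)); first by ring.
by move=> j ji; rewrite eq_sym (negbTE ji) addr0.
Qed.

End spectrum.

(** * Convergence of spectral measures *)

Section convergence.
Context (R : realType).

(** A Chebyshev argument: continuity controls [f x - f c] near [c], boundedness together with a
    multiple of [(x - c)^2] controls it elsewhere, and the pointwise bound is averaged. *)
Lemma cvg_mean_bounded (s_ : nat -> seq R) (c : R) (f : R -> R) :
  (forall n, size (s_ n) = n) ->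
  (n%:R^-1 * \sum_(x <- s_ n) (x - c) ^+ 2) @[n --> \oo] --> 0 ->
  continuous f -> bounded_fun f ->
  (n%:R^-1 * \sum_(x <- s_ n) f x) @[n --> \oo] --> f c.
Proof.
move=> sz sc cf [M [Mr /(_ (Num.max M 0 + 1)) Mf]].
have {}Mf x : `|f x| <= Num.max M 0 + 1.
  by apply: Mf => //; rewrite ltr_pwDr// le_max lexx.
set K := Num.max M 0 + 1 in Mf.
have K0 : 0 <= K by apply: le_trans (Mf 0).
apply/cvgrPdist_le => e e0.
have e2 : 0 < e / 2 by rewrite divr_gt0.
have [dlt /= d0 fd] : exists2 dlt : R, 0 < dlt &
    forall x, `|c - x| < dlt -> `|f c - f x| <= e / 2.
  have /cvgrPdist_le /(_ _ e2) := cf c.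
  by rewrite near_nbhs => -[dlt /= d0 fd]; exists dlt => // x cx; exact: fd.
(* Chosen so that [C * (x - c)^2 >= 2 * K] as soon as [|c - x| >= dlt]. *)
pose C := 2 * K / dlt ^+ 2.
have C0 : 0 <= C by apply: divr_ge0; [exact: mulr_ge0|exact: sqr_ge0].
have bnd x : `|f c - f x| <= e / 2 + C * (x - c) ^+ 2.
  have [xd|xd] := ltP `|c - x| dlt.
    by apply: le_trans (fd x xd) _; rewrite lerDl mulr_ge0// ?sqr_ge0.
  apply: le_trans (_ : 2 * K <= _).
    by apply: le_trans (ler_normB _ _) _; rewrite mulr2n mulrDl mul1r lerD.
  apply: le_trans (_ : C * (x - c) ^+ 2 <= _); last by rewrite lerDr ltW.
  rewrite /C -mulrA ler_peMr ?mulr_ge0// mulrC ler_pdivlMr ?exprn_gt0// mul1r.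
  by rewrite -(real_normK (num_real (x - c))) distrC lerXn2r// nnegrE// ltW.
(* The denominator [C + 1] is positive and gives [C / (C + 1) <= 1], so the quadratic term costs at
   most [e / 2]. *)
have /cvgrPdist_le /(_ (e / 2 / (C + 1))) := sc.
rewrite divr_gt0 ?ltr_wpDl// => /(_ isT) near_sc.
near=> n.
have n0 : (0 < n)%N by near: n; exact: nbhs_infty_gt.
have nR : (n%:R : R) != 0 by rewrite pnatr_eq0 -lt0n.
have -> : f c - n%:R^-1 * (\sum_(x <- s_ n) f x) =
          n%:R^-1 * \sum_(x <- s_ n) (f c - f x).
  rewrite sumrB mulrBr; congr (_ - _).
  by rewrite big_const_seq count_predT sz iter_addr_0 -[f c *+ n]mulr_natl mulKf.
rewrite normrM ger0_norm ?invr_ge0//.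
apply: le_trans (_ : n%:R^-1 * \sum_(x <- s_ n) (e / 2 + C * (x - c) ^+ 2) <= _).
  rewrite ler_wpM2l ?invr_ge0//; apply: le_trans (ler_norm_sum _ _ _) _.
  by apply: ler_sum => x _; exact: bnd.
rewrite big_split /= mulrDr big_const_seq count_predT sz iter_addr_0.
rewrite -[e / 2 *+ n]mulr_natl mulKf// -mulr_sumr mulrCA.
rewrite [leRHS](splitr e) lerD2l.
have : `|0 - n%:R^-1 * \sum_(x <- s_ n) (x - c) ^+ 2| <= e / 2 / (C + 1).
  by near: n.
rewrite sub0r normrN ger0_norm; last first.
  by rewrite mulr_ge0 ?invr_ge0// sumr_ge0// => x _; exact: sqr_ge0.
move=> h; apply: le_trans (ler_wpM2l C0 h) _.
rewrite mulrCA ler_piMr//; first exact: ltW.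
by rewrite ler_pdivrMr ?ltr_wpDl// mul1r lerDl.
Unshelve. all: by end_near. Qed.

(* The block n <= k < 2n of the series is at least n * a n / (2 n)^4. *)
Lemma cvg_monotone_of_series (a : nat -> R) :
  (forall n, 0 <= a n) -> {homo a : n m / (n <= m)%N >-> n <= m} ->
  (\sum_(n <oo) (a n / n.+1%:R ^+ 4)%:E < +oo)%E ->
  (a n / n%:R ^+ 3) @[n --> \oo] --> 0.
Proof.
move=> a0 a_nd sa; pose u n := a n / n.+1%:R ^+ 4.
have u0 n : 0 <= u n by rewrite divr_ge0// exprn_ge0.
have cu : cvgn (series u) := nnseries_is_cvg u0 sa.
(* The block sums are differences of partial sums with the same limit; the factor 16 compensates
   [(2 n)^4 = 16 n^4]. *)
have cd : (16 * (series u n.*2 - series u n)) @[n --> \oo] --> 0.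
  rewrite -(mulr0 16); apply: cvgMr; rewrite -(subrr (limn (series u))).
  apply: cvgB => //; apply: (cvg_comp _ (series u) _ cu).
  move=> A [N _ NA]; exists N => // n /= Nn; apply: NA => /=.
  by rewrite (leq_trans Nn)// -addnn leq_addr.
apply: (@squeeze_cvgr _ _ _ _ (cst 0)
  (fun n => 16 * (series u n.*2 - series u n))); [|exact: cvg_cst|exact: cd].
near=> n; rewrite divr_ge0 ?exprn_ge0//=.
have n0 : (0 < n)%N by near: n; exact: nbhs_infty_gt.
have nR : (0 : R) < n%:R by rewrite ltr0n.
rewrite sub_double_series.
(* The constant sum equals [a n / n^3] exactly; it is a lower bound because [n <= k < 2 n] gives
   [a n <= a k] and [k + 1 <= 2 n]. *)
apply: le_trans (_ : 16 * \sum_(n <= k < n.*2) (a n / (n.*2)%:R ^+ 4) <= _).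
  rewrite big_const_nat iter_addr_0 -addnn addnK -mulr_natl natrD.
  by rewrite le_eqVlt; apply/orP; left; apply/eqP; field; rewrite !gt_eqF ?addr_gt0.
rewrite ler_pM2l//; apply: ler_sum_nat => k /andP[nk kn].
rewrite ler_pM ?a_nd ?invr_ge0 ?exprn_ge0//.
by rewrite lef_pV2 ?posrE ?exprn_gt0 ?ltr0n ?double_gt0// lerXn2r ?nnegrE ?ler_nat.
Unshelve. all: by end_near. Qed.

(** The terms of a convergent series tend to 0, hence so do their square roots. Passing from [n + 1]
    to [n] in the denominator costs a factor 8, as [n + 1 <= 2 n] for positive [n]. *)
Lemma cvg_of_sqr_series (a : nat -> R) :
  (\sum_(n <oo) ((a n / n.+1%:R ^+ 3) ^+ 2)%:E < +oo)%E ->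
  (a n / n%:R ^+ 3) @[n --> \oo] --> 0.
Proof.
move=> sa; have sqr0 n : 0 <= (a n / n.+1%:R ^+ 3) ^+ 2 by exact: sqr_ge0.
have := cvg_series_cvg_0 (nnseries_is_cvg sqr0 sa) => c0.
apply/cvgrPdist_le => e e0.
have e8 : 0 < (e / 8) ^+ 2 by rewrite exprn_gt0// divr_gt0.
have /cvgrPdist_le /(_ _ e8) near0 := c0.
near=> n; rewrite sub0r normrN.
have n0 : (0 < n)%N by near: n; exact: nbhs_infty_gt.
have nR : (0 : R) < n%:R by rewrite ltr0n.
have : `|0 - (a n / n.+1%:R ^+ 3) ^+ 2| <= (e / 8) ^+ 2 by near: n.
rewrite sub0r normrN normrX ler_pXn2r// ?nnegrE//; last by rewrite ltW// divr_gt0.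
move=> h.
apply: le_trans (_ : 8 * `|a n / n.+1%:R ^+ 3| <= _); last first.
  by rewrite mulrC -ler_pdivlMr.
rewrite !normrM mulrCA ler_wpM2l// !normfV !ger0_norm ?exprn_ge0//.
rewrite -[leRHS]invrK lef_pV2 ?posrE ?exprn_gt0 ?invr_gt0 ?mulr_gt0 ?invr_gt0 ?exprn_gt0//.
rewrite invfM invrK mulrC ler_pdivrMr// mulrC.
rewrite (_ : 8 = 2 ^+ 3)// ; last by rewrite -natrX.
rewrite -exprMn lerXn2r ?nnegrE ?mulr_ge0// -natrM ler_nat; lia.
Unshelve. all: by end_near. Qed.

Lemma inv_sqr_series_lty (C : R) : 0 <= C ->
  (\sum_(n <oo) (C / n.+1%:R ^+ 2)%:E < +oo)%E.
Proof.
move=> C0; apply: (@le_lt_trans _ _ (C * 2)%:E); last exact: ltry.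
apply: lime_le; first by apply: is_cvg_nneseries => n _ _; rewrite lee_fin divr_ge0 ?exprn_ge0.
apply: nearW => n; rewrite sumEFin lee_fin -mulr_sumr ler_wpM2l//.
case: n => [|n]; first by rewrite big_geq.
(* The sharper bound [2 - 1 / (n + 1)] on the sum of the first [n + 1] terms is inductive, unlike
   the bound 2 itself. *)
apply: le_trans (_ : 2 - n.+1%:R^-1 <= _); last by rewrite gerBl invr_ge0.
elim: n => [|n IH]; first by rewrite big_nat1 expr1n invr1; lra.
rewrite big_nat_recr//=; apply: le_trans (lerD IH (lexx _)) _.
rewrite -subr_ge0.
have n1 : (0 : R) < n.+1%:R by rewrite ltr0n.
have -> : (2 : R) - n.+2%:R^-1 - (2 - n.+1%:R^-1 + (n.+2%:R ^+ 2)^-1) =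
  (n.+1%:R * n.+2%:R ^+ 2)^-1.
  rewrite -[n.+2]addn1 natrD; field.
  by rewrite !gt_eqF// -(natrD _ n.+1 1) ltr0n.
by rewrite invr_ge0 mulr_ge0// exprn_ge0.
Qed.

(** The formula is first proved for nonnegative functions, then applied to the positive and negative
    parts of [f]. *)
Lemma integral_spectral_measure n (A : 'M[R]_n) (f : R -> R) : A^T = A ->
  measurable_fun setT f ->
  (\int[spectral_measure A]_x (f x)%:E =
   (n%:R^-1 * \sum_(x <- eigenvals A) f x)%:E)%E.
Proof.
move=> symA mf; have szA := size_ordered_spectrum (eigenvals_symmetric symA).
have mfE : measurable_fun setT (EFin \o f) by exact/measurable_EFinP.
have nn (g : R -> \bar R) : measurable_fun setT g -> (forall x, 0 <= g x)%E ->
  (\int[spectral_measure A]_x g x = (n%:R^-1)%:E * \sum_(x <- eigenvals A) g x)%E.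
  move=> mg g0; rewrite ge0_integral_mscale//; congr (_ * _)%E.
  rewrite ge0_integral_measure_sum//.
  (* Symmetry gives exactly [n] eigenvalues, so the default 0 of [nth] is never read. *)
  rewrite (big_nth 0) szA big_mkord; apply: eq_bigr => i _.
  by rewrite integral_dirac// diracT mul1e.
rewrite integralE !nn//; [|exact: measurable_funeneg|exact: measurable_funepos].
under eq_bigr do rewrite funeposE -EFin_max.
under [X in (_ - _ * X)%E]eq_bigr do rewrite funenegE -EFinN -EFin_max.
rewrite !sumEFin -!EFinM -EFinB -mulrBr -sumrB; congr (_ * _)%:E.
apply: eq_bigr => x _; rewrite /Num.max; by case: ltP => ?; case: ltP => ?; lra.
Qed.

End convergence.

(** * Moments of products of centered entries *)

Section moments.
Context d (T : measurableType d) (R : realType) (P : probability T R).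

Lemma integrable_eq_distribution (X Y : {RV P >-> R}) (f : R -> R) :
  (forall B, measurable B -> distribution P X B = distribution P Y B) ->
  measurable_fun setT f ->
  P.-integrable setT (fun w => (f (X w))%:E) ->
  P.-integrable setT (fun w => (f (Y w))%:E).
Proof.
move=> XY mf /integrableP[mfX fX]; apply/integrableP; split.
  by apply/measurable_EFinP; exact: measurableT_comp.
have mabs : measurable_fun setT (fun x : R => `|(f x)%:E|%E).
  by apply: measurableT_comp => //; exact/measurable_EFinP.
rewrite -(ge0_integral_distribution Y mabs) => [|y]; last exact: abse_ge0.
rewrite (eq_measure_integral (distribution P X)) => [|A mA _]; last exact/esym/XY.
by rewrite (ge0_integral_distribution X mabs) => [|y]; last exact: abse_ge0.
Qed.

Lemma expectation_eq_distribution (X Y : {RV P >-> R}) (f : R -> R) :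
  (forall B, measurable B -> distribution P X B = distribution P Y B) ->
  measurable_fun setT f ->
  P.-integrable setT (fun w => (f (X w))%:E) ->
  (\int[P]_w (f (Y w))%:E = \int[P]_w (f (X w))%:E)%E.
Proof.
move=> XY mf iX; have iY := integrable_eq_distribution XY mf iX.
have mfE : measurable_fun setT (EFin \o f) by exact/measurable_EFinP.
have /= <- := integral_distribution mfE iY.
have /= <- := integral_distribution mfE iX.
by apply: eq_measure_integral => A mA _; exact/esym/XY.
Qed.

(** By Tonelli the sum of the series has finite expectation, so it is finite almost surely. *)
Lemma ae_series_lty (f : nat -> T -> R) (C : R) : 0 <= C ->
  (forall n, measurable_fun setT (f n)) -> (forall n w, 0 <= f n w) ->
  (forall n, (\int[P]_w (f n w)%:E <= (C / n.+1%:R ^+ 2)%:E)%E) ->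
  {ae P, forall w, (\sum_(n <oo) (f n w)%:E < +oo)%E}.
Proof.
move=> C0 mf f0 fC.
have mfE n : measurable_fun setT (fun w => (f n w)%:E) by exact/measurable_EFinP.
have f0E n w : setT w -> (0 <= (f n w)%:E)%E by rewrite lee_fin.
have S0 w : (0 <= \sum_(n <oo) (f n w)%:E)%E.
  by apply: nneseries_ge0 => n _ _; rewrite lee_fin.
have ip : P.-integrable setT (fun w => \sum_(n <oo) (f n w)%:E)%E.
  apply/integrableP; split.
    by apply: ge0_emeasurable_sum => // n w _ _; exact: f0E.
  under eq_integral do rewrite gee0_abs//.
  rewrite integral_nneseries//.
  apply: le_lt_trans (inv_sqr_series_lty C0).
  apply: lee_nneseries => [n _ _|n _]; last exact: fC.
  by apply: integral_ge0 => w; exact: f0E.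
have := integrable_ae measurableT ip; apply: filterS => w /(_ I).
by rewrite ge0_fin_numE.
Qed.

End moments.

Section centered_words.
Context d (T : measurableType d) (R : realType) (P : probability T R).
Context (I : choiceType) (D : set I) (X : I -> {RV P >-> R}) (m : R) (i0 : I).
Hypothesis X_iid : iid D X.
Hypothesis Di0 : D i0.
Hypothesis X_mean : ('E_P[X i0] = m%:E)%E.
Hypothesis X_sq : ('E_P[fun w => (X i0 w ^+ 2)%R] < +oo)%E.

Let y i w := X i w - m.
Let moment k := (\int[P]_w (y i0 w ^+ k))%R.

Let mpow k : measurable_fun setT (fun x : R => (x - m) ^+ k).
Proof. by apply: measurable_funX; exact: measurable_funB. Qed.

Let integrable_pow0 k : (k <= 2)%N -> P.-integrable setT (fun w => (y i0 w ^+ k)%:E).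
Proof.
move=> k2.
have isq : P.-integrable setT (fun w => (X i0 w ^+ 2)%:E).
  apply/integrableP; split; first by apply/measurable_EFinP; exact: measurable_funX.
  under eq_integral do rewrite gee0_abs ?lee_fin ?sqr_ge0//.
  by move: X_sq; rewrite unlock.
(* For [k <= 2], [|X - m|^k <= 1 + (X - m)^2 <= 1 + 2 m^2 + 2 X^2]; the last gap is [(X + m)^2]. *)
have ibd : P.-integrable setT (fun w => (1 + 2 * m ^+ 2)%:E + 2%:E * (X i0 w ^+ 2)%:E)%E.
  apply: integrableD => //; last exact: integrableZl.
  by apply: finite_measure_integrable_cst.
apply: (le_integrable _ _ _ ibd) => //.
  apply/measurable_EFinP; exact: (measurableT_comp (mpow k)).
move=> w _; rewrite -EFinM -EFinD !abse_EFin lee_fin /y.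
have h : 1 + (X i0 w - m) ^+ 2 <= 1 + 2 * m ^+ 2 + 2 * X i0 w ^+ 2.
  by rewrite -subr_ge0 [leRHS](_ : _ = (X i0 w + m) ^+ 2) ?sqr_ge0//; ring.
apply: le_trans (ler_norm _); apply: le_trans h; rewrite normrX.
rewrite -(real_normK (num_real (X i0 w - m))).
have := normr_ge0 (X i0 w - m); move: `|_| => z z0.
case: k k2 => [|[|[|//]]] _; rewrite ?expr0 ?expr1.
- by rewrite lerDl exprn_ge0.
- by have := sqr_ge0 (z - 1); nra.
- by rewrite lerDr.
Qed.

Let distE i : D i -> forall B, measurable B -> distribution P (X i0) B = distribution P (X i) B.
Proof. by move=> Di B mB; apply: X_iid.2. Qed.

Let integrable_pow i k : D i -> (k <= 2)%N -> P.-integrable setT (fun w => (y i w ^+ k)%:E).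
Proof.
move=> Di k2.
exact: (integrable_eq_distribution (distE Di) (mpow k) (integrable_pow0 k2)).
Qed.

Let expectation_pow i k : D i -> (k <= 2)%N -> (\int[P]_w (y i w ^+ k))%R = moment k.
Proof.
move=> Di k2; congr fine.
exact: (expectation_eq_distribution (distE Di) (mpow k) (integrable_pow0 k2)).
Qed.

Let moment1 : moment 1 = 0.
Proof.
rewrite /moment /Rintegral /y; have i1 := @integrable_pow0 1 isT.
have iX : P.-integrable setT (fun w => (X i0 w)%:E).
  have -> : (fun w => (X i0 w)%:E) = (fun w => (y i0 w ^+ 1)%:E + m%:E)%E.
    by apply/funext => w; rewrite expr1 /y EFinB subeK.
  by apply: integrableD => //; exact: finite_measure_integrable_cst.
under eq_integral do rewrite expr1 EFinB.
rewrite integralB//; last exact: finite_measure_integrable_cst.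
move: X_mean; rewrite unlock => ->.
by rewrite integral_cst//= [P _]probability_setT mule1 subee.
Qed.

(** Equal letters are grouped into powers of distinct, hence independent, variables. Multiplicity at
    most 2 keeps every power integrable under a finite second moment. *)
Let expectation_word (l : seq I) : {in l, forall i, D i} ->
  (forall i, (count_mem i l <= 2)%N) ->
  P.-integrable setT (fun w => (\prod_(i <- l) y i w)%:E) /\
  (\int[P]_w (\prod_(i <- l) y i w)%:E =
   (\prod_(i <- undup l) moment (count_mem i l))%:E)%E.
Proof.
move=> lD l2; pose g i x : R := (x - m) ^+ count_mem i l.
have gE w : \prod_(i <- l) y i w = \prod_(i <- undup l) g i (X i w).
  by rewrite -prodr_undup_exp_count.
have uD : {in undup l, forall i, D i} by move=> i; rewrite mem_undup => /lD.
have ig : {in undup l, forall i, P.-integrable setT (fun w => (g i (X i w))%:E)}.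
  by move=> i /uD Di; exact: integrable_pow.
under eq_fun do rewrite gE.
have mg i : measurable_fun setT (g i) by exact: mpow.
have iprod := integrable_prod X_iid.1 (undup_uniq l) uD mg ig.
split=> //.
rewrite -[LHS]fineK; last exact: integrable_fin_num.
congr EFin; rewrite [LHS](expectation_prod X_iid.1 (undup_uniq l) uD mg ig).
by apply: eq_big_seq => i /uD Di; rewrite expectation_pow.
Qed.

(** If the two pairs agree up to order, each index occurs twice and the variance appears squared;
    otherwise some index occurs exactly once, and its zero mean kills the product. *)
Lemma centered_four i j k l : D i -> D j -> D k -> D l -> i != j -> k != l ->
  P.-integrable setT (fun w => (y i w * y j w * (y k w * y l w))%:E) /\
  (\int[P]_w (y i w * y j w * (y k w * y l w))%:E =
   ((moment 2) ^+ 2 *+ perm_eq [:: i; j] [:: k; l])%:E)%E.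
Proof.
move=> Di Dj Dk Dl ij kl.
have wD : {in [:: i; j; k; l], forall i, D i}.
  by move=> e; rewrite !inE => /or4P[] /eqP ->.
have w2 e : (count_mem e [:: i; j; k; l] <= 2)%N.
  (* Each pair has distinct entries, so it contributes at most one occurrence of [e]. *)
  have le1 a b : a != b -> ((a == e) + (b == e) <= 1)%N.
    by case: (eqVneq a e) => [->|_ _]; [rewrite eq_sym => /negPf ->|case: (b == e)].
  by have := leq_add (le1 _ _ ij) (le1 _ _ kl); rewrite /= addn0 !addnA.
have [iw Ew] := expectation_word wD w2.
have wE w : \prod_(e <- [:: i; j; k; l]) y e w = y i w * y j w * (y k w * y l w).
  by rewrite !big_cons big_nil mulr1 !mulrA.
move: iw; under eq_fun do rewrite wE; move=> iw.
move: Ew; under eq_integral do rewrite wE; move=> Ew; split=> //; rewrite Ew.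
congr EFin.
have ji : j != i by rewrite eq_sym.
case: (boolP (perm_eq _ _)) => [pij|npij].
  have [[ki lj]|[kj li]] : (k = i /\ l = j) \/ (k = j /\ l = i).
    have := perm_mem pij k; have := perm_mem pij l.
    rewrite !inE !eqxx orbT => /orP[] /eqP lE /orP[] /eqP kE;
      move: kl; rewrite kE lE ?eqxx//; by [left|right].
  - by rewrite ki lj /= !inE !eqxx (negbTE ij) (negbTE ji) /=
      !big_cons big_nil /= !eqxx (negbTE ij) (negbTE ji) mulr1 expr2.
  - by rewrite kj li /= !inE !eqxx (negbTE ij) (negbTE ji) /=
      !big_cons big_nil /= !eqxx (negbTE ij) (negbTE ji) mulr1 expr2.
(* If [i] recurs in the second pair, [j] cannot, since the pairs would then match; so [j] is the
   single index. Otherwise [i] is. *)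
have [e el e1] : exists2 e, e \in [:: i; j; k; l] & count_mem e [:: i; j; k; l] = 1%N.
  have [ik|ik] := eqVneq k i; last have [il|il] := eqVneq l i.
  - exists j; first by rewrite !inE eqxx !orbT.
    rewrite /= eqxx (negbTE ij) ik (negbTE ij) /= ; case: eqVneq => // lj.
    by move: npij; rewrite ik lj perm_refl.
  - exists j; first by rewrite !inE eqxx !orbT.
    rewrite /= eqxx (negbTE ij) il (negbTE ij) /= ; case: eqVneq => // kj.
    by move: npij; rewrite il kj (perm_catC [:: i] [:: j]) perm_refl.
  - by exists i; rewrite ?inE ?eqxx//= eqxx (negbTE ji) (negbTE ik) (negbTE il).
by rewrite (big_rem e) ?mem_undup//= -/(count_mem e [:: i; j; k; l]) e1 moment1 mul0r.
Qed.

Lemma centered_sqr i : D i ->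
  P.-integrable setT (fun w => (y i w ^+ 2)%:E) /\
  (\int[P]_w (y i w ^+ 2)%:E = (moment 2)%:E)%E.
Proof.
move=> Di; have i2 := @integrable_pow i 2 Di isT; split=> //.
by rewrite -(@expectation_pow i 2 Di isT) fineK// integrable_fin_num.
Qed.

End centered_words.

(** * Row sums *)

Section row_sums.
Context (R : realType).
Implicit Types (x y : nat -> nat -> R) (n : nat).

Definition sqr_sum y n := \sum_(i < n) \sum_(j < n | j != i) y i j ^+ 2.

(* Ordered pairs of distinct edges i - j and i - k sharing the vertex i: the
   cross terms in the square of the i-th row sum. *)
Definition cherry y (i j k : nat) : R := y i j * y i k *+ uniq [:: i; j; k].

Definition cherry_sum y n :=
  \sum_(t : 'I_n * 'I_n * 'I_n) cherry y t.1.1 t.1.2 t.2.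

Lemma sqr_sum_ge0 y n : 0 <= sqr_sum y n.
Proof. by apply: sumr_ge0 => i _; apply: sumr_ge0 => j _; exact: sqr_ge0. Qed.

Lemma sqr_sum_nondecreasing y : {homo sqr_sum y : n m / (n <= m)%N >-> n <= m}.
Proof.
move=> n m nm.
have widen (p : pred nat) (F : nat -> R) : (forall i, 0 <= F i) ->
    \sum_(i < n | p i) F i <= \sum_(i < m | p i) F i.
  move=> F0; rewrite (big_ord_widen_cond m p F nm) big_mkcond [leRHS]big_mkcond.
  by apply: ler_sum => i _; case: (p i) => //=; case: (i < n)%N.
apply: le_trans (_ : \sum_(i < n) \sum_(j < m | j != i :> nat) y i j ^+ 2 <= _).
  apply: ler_sum => i _.
  by apply: (widen (fun j => j != i) (fun j => y i j ^+ 2)) => j; exact: sqr_ge0.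
apply: (widen xpredT (fun i => \sum_(j < m | j != i :> nat) y i j ^+ 2)) => i.
by apply: sumr_ge0 => j _; exact: sqr_ge0.
Qed.

(** In the expanded square of a row sum, the terms [k = j] give the squares and the terms [k != j]
    the cherries. *)
Lemma sum_row_sqr y n :
  \sum_(i < n) (\sum_(j < n | j != i) y i j) ^+ 2 = sqr_sum y n + cherry_sum y n.
Proof.
rewrite /cherry_sum -(pair_bigA _ (fun (p : 'I_n * 'I_n) (k : 'I_n) => cherry y p.1 p.2 k)) /=.
rewrite -(pair_bigA _ (fun (i j : 'I_n) => \sum_(k < n) cherry y i j k)) /=.
rewrite -big_split /=; apply: eq_bigr => i _.
rewrite [X in _ + X](bigID (fun j => j == i)) /= [X in _ + (X + _)]big1 ?add0r; last first.
  by move=> j /eqP ->; rewrite big1// => k _; rewrite /cherry /= inE eqxx.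
rewrite expr2 big_distrlr -big_split /=; apply: eq_bigr => j ji.
rewrite (bigD1 j)//= expr2; congr (_ + _).
rewrite big_mkcond; apply: eq_bigr => k _.
have ijN : (i == j :> nat) = false.
  by apply/negbTE; rewrite eq_sym (inj_eq (@ord_inj n)).
rewrite /cherry /= !inE !andbT ijN /= -!(inj_eq (@ord_inj n)).
by rewrite (eq_sym (i : nat)) (eq_sym (j : nat)); case: ifP.
Qed.

(** The left side is the squared Frobenius norm of [M / n + m I], divided by [n]. Each row is
    bounded through [(a + b)^2 <= 2 a^2 + 2 b^2]; squares of entries enter from off the diagonal and
    through the squared row sums, whence [4 = 2 + 2]. *)
Lemma laplacian_sqr_dist x n (m : R) : (0 < n)%N ->
  n%:R^-1 * (\sum_(i < n) \sum_(j < n)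
    (n%:R^-1 * (x i j - (\sum_(k < n) x i k) *+ (i == j)) + m *+ (i == j)) ^+ 2) <=
  4 * (sqr_sum (fun i j => x i j - m) n / n%:R ^+ 3)
  + 2 * (cherry_sum (fun i j => x i j - m) n / n%:R ^+ 3)
  + 2 * m ^+ 2 * n%:R^-1.
Proof.
pose y i j := x i j - m; rewrite -/y => n0; have nR : (0 : R) < n%:R by rewrite ltr0n.
have nz : (n%:R : R) != 0 by rewrite gt_eqF.
have -> : 4 * (sqr_sum y n / n%:R ^+ 3) + 2 * (cherry_sum y n / n%:R ^+ 3)
  + 2 * m ^+ 2 * n%:R^-1 = n%:R^-1 * (n%:R ^- 2 *
  (2 * n%:R * m ^+ 2 * n%:R + 2 * (sqr_sum y n + cherry_sum y n) + 2 * sqr_sum y n)).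
  by field.
rewrite ler_pM2l ?invr_gt0// -sum_row_sqr.
have -> : 2 * n%:R * m ^+ 2 * n%:R = \sum_(i < n) (2 * n%:R * m ^+ 2).
  by rewrite sumr_const card_ord mulr_natr.
rewrite /sqr_sum !mulr_sumr -!big_split /= mulr_sumr; apply: ler_sum => i _.
have sumD1 (a : R) : n%:R * a = a + \sum_(k < n | k != i) a.
  by rewrite mulr_natl -[in LHS](card_ord n) -sumr_const (bigD1 i).
have nm := sumD1 m; have nm2 := sumD1 (m ^+ 2).
rewrite (bigD1 i)//= eqxx !mulr1n.
set S := \sum_(j < n | j != i) y i j.
(* The entry [x i i] cancels, and centering the other [n - 1] terms removes all but one of the [n]
   copies of [m]. *)
have -> : n%:R^-1 * (x i i - \sum_(k < n) x i k) + m = n%:R^-1 * (m - S).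
  have -> : \sum_(k < n) x i k = x i i + (S + \sum_(k < n | k != i) m).
    by rewrite (bigD1 i)//= -big_split; congr (_ + _); apply: eq_bigr => k _; rewrite /= /y subrK.
  by rewrite (_ : \sum_(k < n | k != i) m = n%:R * m - m); [field|rewrite nm addrC addKr].
have offdiag : \sum_(j < n | j != i)
    (n%:R^-1 * (x i j - (\sum_(k < n) x i k) *+ (i == j)) + m *+ (i == j)) ^+ 2 <=
    n%:R ^- 2 * (2 * (\sum_(j < n | j != i) y i j ^+ 2) + 2 * \sum_(k < n | k != i) m ^+ 2).
  rewrite !mulr_sumr -big_split mulr_sumr; apply: ler_sum => j ji.
  rewrite eq_sym (negbTE ji) mulr0n subr0 addr0 exprMn exprVn.
  rewrite ler_pM2l ?invr_gt0 ?exprn_gt0//.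
  rewrite -subr_ge0 [leRHS](_ : _ = (x i j - 2 * m) ^+ 2) ?sqr_ge0//.
  by rewrite /y /=; ring.
apply: le_trans (lerD (lexx _) offdiag) _.
rewrite exprMn exprVn -mulrDr ler_pM2l ?invr_gt0 ?exprn_gt0//.
have -> : 2 * n%:R * m ^+ 2 = 2 * (m ^+ 2 + \sum_(k < n | k != i) m ^+ 2).
  by rewrite -nm2 mulrA.
have := sqr_ge0 (m + S); lra.
Qed.

End row_sums.

(* The edge joining i and j is encoded as (minn i j, maxn i j). *)
Lemma edge_pair_inj (i j k i' j' k' : nat) :
  uniq [:: i; j; k] -> uniq [:: i'; j'; k'] ->
  perm_eq [:: (minn i j, maxn i j); (minn i k, maxn i k)]
          [:: (minn i' j', maxn i' j'); (minn i' k', maxn i' k')] ->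
  (i', j', k') = (i, j, k) \/ (i', j', k') = (i, k, j).
Proof.
have edge_eq a b a' b' : (minn a b, maxn a b) = (minn a' b', maxn a' b') ->
    (a = a' /\ b = b') \/ (a = b' /\ b = a') by case=> h1 h2; lia.
have uniq3 a b c : uniq [:: a; b; c] -> [/\ a <> b, a <> c & b <> c].
  rewrite /= !inE negb_or andbT => /andP[/andP[/eqP ? /eqP ?] /eqP ?]; by split.
move=> /uniq3[ij ik jk] /uniq3[ij' ik' jk'] /perm_mem pe.
have := pe (minn i' j', maxn i' j'); have := pe (minn i' k', maxn i' k').
rewrite !inE !eqxx orbT /= => /orP hk /orP hj.
(* The centre is the only vertex common to both edges, so only the two leaves can be exchanged. *)
suff : (i' = i /\ j' = j /\ k' = k) \/ (i' = i /\ j' = k /\ k' = j).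
  by case=> -[-> [-> ->]]; [left|right].
case: hj => /eqP/edge_eq; case: hk => /eqP/edge_eq; lia.
Qed.

(** * Moment bounds and almost sure convergence of the random sums *)

Section random_sums.
Context d (T : measurableType d) (R : realType) (P : probability T R).
Context (X : nat -> nat -> {RV P >-> R}) (m : R).
Hypothesis X_iid : iid [set ij : nat * nat | (ij.1 <= ij.2)%N] (fun ij => X ij.1 ij.2).
Hypothesis X_mean : ('E_P[X 0%N 1%N] = m%:E)%E.
Hypothesis X_sq : ('E_P[fun w => (X 0%N 1%N w ^+ 2)%R] < +oo)%E.

(** Reading entries through [minn] and [maxn] makes [y w] symmetric and keeps every index pair
    inside the i.i.d. family. *)
Let y w i j := X (minn i j) (maxn i j) w - m.
Let var := (\int[P]_w ((X 0%N 1%N w - m) ^+ 2))%R.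

Let var_ge0 : 0 <= var.
Proof. by apply: Rintegral_ge0 => w _; exact: sqr_ge0. Qed.

Let edgeP i j : [set ij : nat * nat | (ij.1 <= ij.2)%N] (minn i j, maxn i j).
Proof. by rewrite /=; lia. Qed.

Let my i j : measurable_fun setT (fun w => y w i j).
Proof. exact: measurable_funB. Qed.

Let expectation_sqr_sum n :
  (\int[P]_w (sqr_sum (y w) n)%:E <= (var * n%:R ^+ 2)%:E)%E.
Proof.
have y2 i j := centered_sqr (i0 := (0, 1)%N) m X_iid isT X_sq (edgeP i j).
under eq_integral do rewrite /sqr_sum -sumEFin.
rewrite integral_sum//; last first.
  move=> i; under eq_fun do rewrite -sumEFin.
  by apply: integrable_sum => // j _; exact: (y2 i j).1.
apply: (@le_trans _ _ (\sum_(i < n) (\sum_(j < n) var)%:E)%E); last first.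
  by rewrite sumEFin lee_fin !sumr_const !card_ord -[_ *+ n *+ n]mulrnA
    -[leLHS]mulr_natr natrM expr2.
apply: lee_sum => i _; under eq_integral do rewrite -sumEFin.
rewrite integral_sum//; last by move=> j; exact: (y2 i j).1.
rewrite (eq_bigr (fun=> var%:E)) => [|j _]; last exact: (y2 i j).2.
(* Adding the diagonal replaces the exact count [n (n - 1)] by [n^2]. *)
rewrite sumEFin lee_fin [leRHS](bigID (fun j => j != i)) /= lerDl.
by apply: sumr_ge0 => j _; exact: var_ge0.
Qed.

(** For a fixed triple [t], a product of two cherries can have nonzero mean only if the other triple
    is [t] or [swap t], which exchanges the leaves. Each of the [n^3] triples thus contributes at
    most [2 * var ^+ 2]. *)
Let expectation_cherry_sum n :
  (\int[P]_w (cherry_sum (y w) n ^+ 2)%:E <= (2 * var ^+ 2 * n%:R ^+ 3)%:E)%E.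
Proof.
pose I3 := ('I_n * 'I_n * 'I_n)%type.
pose c w (t : I3) := cherry (y w) t.1.1 t.1.2 t.2.
pose swap (t : I3) : I3 := (t.1.1, t.2, t.1.2).
have edge_neq (i j k : nat) : uniq [:: i; j; k] -> (minn i j, maxn i j) != (minn i k, maxn i k).
  by rewrite /= !inE xpair_eqE; lia.
have cc t t' : P.-integrable setT (fun w => (c w t * c w t')%:E) /\
   (\int[P]_w (c w t * c w t')%:E <=
     (var ^+ 2 * ((t' == t)%:R + (t' == swap t)%:R))%:E)%E.
  have [ut|ut] := boolP (uniq [:: t.1.1 : nat; t.1.2 : nat; t.2 : nat]); last first.
    have c0 w : c w t * c w t' = 0 by rewrite /c /cherry (negbTE ut) mulr0n mul0r.
    split; [under eq_fun do rewrite c0|under eq_integral do rewrite c0].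
      exact: finite_measure_integrable_cst.
    by rewrite integral0 lee_fin mulr_ge0 ?sqr_ge0// addr_ge0.
  have [ut'|ut'] := boolP (uniq [:: t'.1.1 : nat; t'.1.2 : nat; t'.2 : nat]); last first.
    have c0 w : c w t * c w t' = 0 by rewrite /c /cherry (negbTE ut') mulr0n mulr0.
    split; [under eq_fun do rewrite c0|under eq_integral do rewrite c0].
      exact: finite_measure_integrable_cst.
    by rewrite integral0 lee_fin mulr_ge0 ?sqr_ge0// addr_ge0.
  have [i4 E4] := centered_four (i0 := (0, 1)%N) X_iid isT X_mean X_sq
    (edgeP _ _) (edgeP _ _) (edgeP _ _) (edgeP _ _) (edge_neq _ _ _ ut) (edge_neq _ _ _ ut').
  have cE w : c w t * c w t' = y w t.1.1 t.1.2 * y w t.1.1 t.2 *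
      (y w t'.1.1 t'.1.2 * y w t'.1.1 t'.2).
    by rewrite /c /cherry ut ut' !mulr1n.
  split; [under eq_fun do rewrite cE|under eq_integral do rewrite cE]; first exact: i4.
  rewrite E4 lee_fin -/var -[leLHS]mulr_natr ler_wpM2l ?sqr_ge0//.
  case: (boolP (perm_eq _ _)) => [pe|_]; last exact: addr_ge0.
  have [[i' j' k']|[i' j' k']] := edge_pair_inj ut ut' pe.
  - have -> : t' = t.
      by case: t t' i' j' k' {cE E4 i4 ut ut' pe} =>
        [[i j] k] [[a b] e] /= /ord_inj -> /ord_inj -> /ord_inj ->.
    by rewrite eqxx lerDl.
  - have -> : t' = swap t.
      by case: t t' i' j' k' {cE E4 i4 ut ut' pe} =>
        [[i j] k] [[a b] e] /= /ord_inj -> /ord_inj -> /ord_inj ->.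
    by rewrite eqxx lerDr.
under eq_integral do rewrite expr2 /cherry_sum big_distrlr /= -sumEFin.
rewrite integral_sum//; last first.
  move=> t; under eq_fun do rewrite -sumEFin.
  by apply: integrable_sum => // t' _; exact: (cc t t').1.
apply: (@le_trans _ _ (\sum_(t : I3) (2 * var ^+ 2)%:E)%E); last first.
  rewrite sumEFin lee_fin sumr_const !card_prod !card_ord -[leLHS]mulr_natr.
  by rewrite le_eqVlt; apply/orP; left; apply/eqP; rewrite !natrM; ring.
apply: lee_sum => t _; under eq_integral do rewrite -sumEFin.
rewrite integral_sum//; last by move=> t'; exact: (cc t t').1.
apply: le_trans (lee_sum _ (fun t' _ => (cc t t').2)) _.
rewrite sumEFin lee_fin -mulr_sumr big_split /= mulrC ler_wpM2r ?sqr_ge0//.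
rewrite -!natr_sum -natrD ler_nat.
rewrite (bigD1 t)//= eqxx big1 ?addn0; last by move=> t' /negPf ->.
by rewrite (bigD1 (swap t))//= eqxx big1// => t' /negPf ->.
Qed.

(** A first moment bound makes the series of [sqr_sum / (n + 1)^4] converge almost surely;
    monotonicity in [n] then yields the rate [n^3]. *)
Lemma ae_sqr_sum_cvg :
  {ae P, forall w, (sqr_sum (y w) n / n%:R ^+ 3) @[n --> \oo] --> 0}.
Proof.
have mA n : measurable_fun setT (fun w => sqr_sum (y w) n).
  apply: measurable_sum => i; under eq_fun do rewrite big_mkcond /=.
  by apply: measurable_sum => j; case: (j != i) => //; apply: measurable_funX; exact: my.
have := @ae_series_lty _ _ _ P (fun n w => sqr_sum (y w) n / n.+1%:R ^+ 4) var var_ge0.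
have gt0 n : (0 : R) < n.+1%:R by rewrite ltr0n.
case.
- by move=> n; apply: measurable_funM.
- by move=> n w; rewrite divr_ge0 ?sqr_sum_ge0 ?exprn_ge0.
- move=> n; under eq_integral do rewrite mulrC EFinM.
  rewrite ge0_integralZl ?lee_fin ?invr_ge0 ?exprn_ge0//; last 2 first.
  + exact/measurable_EFinP.
  + by move=> w _; rewrite lee_fin sqr_sum_ge0.
  apply: le_trans (lee_wpmul2l _ (expectation_sqr_sum n)) _.
    by rewrite lee_fin invr_ge0 exprn_ge0.
  rewrite -EFinM lee_fin mulrCA ler_wpM2l ?var_ge0//.
  (* One factor [(n + 1)^2] absorbs [n^2]; the other is the summable weight. *)
  rewrite (exprD _ 2 2) invfM -mulrA ler_piMr ?invr_ge0 ?exprn_ge0//.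
  by rewrite ler_pdivrMl ?exprn_gt0// mulr1 lerXn2r ?nnegrE ?ler_nat.
- move=> N [mN PN sN]; exists N; split=> // w /= h; apply: sN => /= s; apply: h.
  exact: cvg_monotone_of_series (sqr_sum_ge0 _) (@sqr_sum_nondecreasing _ _) s.
Qed.

(** Cherry sums have no fixed sign and need not be monotone, so the second moment is used: it makes
    the squares summable at the scale [n^3] itself. *)
Lemma ae_cherry_sum_cvg :
  {ae P, forall w, (cherry_sum (y w) n / n%:R ^+ 3) @[n --> \oo] --> 0}.
Proof.
have mW n : measurable_fun setT (fun w => cherry_sum (y w) n).
  apply: measurable_sum => t; rewrite /cherry; case: (uniq _).
    by under eq_fun do rewrite mulr1n; apply: (measurable_funM (my _ _) (my _ _)).
  by under eq_fun do rewrite mulr0n; exact: measurable_cst.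
have v0 : 0 <= 2 * var ^+ 2 by rewrite mulr_ge0 ?sqr_ge0.
have gt0 n : (0 : R) < n.+1%:R by rewrite ltr0n.
have := @ae_series_lty _ _ _ P (fun n w => (cherry_sum (y w) n / n.+1%:R ^+ 3) ^+ 2) _ v0.
case.
- by move=> n; apply: measurable_funX; exact: measurable_funM.
- by move=> n w; exact: sqr_ge0.
- move=> n; under eq_integral do rewrite mulrC exprMn EFinM.
  rewrite ge0_integralZl ?lee_fin ?sqr_ge0//; last 2 first.
  + by apply/measurable_EFinP; exact: measurable_funX.
  + by move=> w _; rewrite lee_fin sqr_ge0.
  apply: le_trans (lee_wpmul2l _ (expectation_cherry_sum n)) _.
    by rewrite lee_fin sqr_ge0.
  rewrite -EFinM lee_fin mulrCA ler_wpM2l//.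
  (* Of the sixth power in the denominator, four factors absorb [n^3] and two remain as the summable
     weight. *)
  rewrite -exprVn -exprM (exprD _ 2 4) -exprVn -mulrA ler_piMr ?exprn_ge0 ?invr_ge0//.
  rewrite !exprVn ler_pdivrMl ?exprn_gt0// mulr1.
  apply: (@le_trans _ _ (n.+1%:R ^+ 3)); first by rewrite lerXn2r ?nnegrE ?ler_nat.
  by apply: ler_weXn2l; rewrite ?ler1n.
- move=> N [mN PN sN]; exists N; split=> // w /= h; apply: sN => /= s; apply: h.
  exact: cvg_of_sqr_series s.
Qed.

End random_sums.

(** * Almost sure weak convergence of the spectral measures *)

Theorem theorem1p4 (d : measure_display) (T : measurableType d) (R : realType)
    (P : probability T R) (X : nat -> nat -> {RV P >-> R}) (m : R)
    (X_iid : iid [set ij : nat * nat | (ij.1 <= ij.2)%N] (fun ij => X ij.1 ij.2))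
    (X_mean : ('E_P[X 0%N 1%N] = m%:E)%E)
    (X_sq : ('E_P[fun w => (X 0%N 1%N w ^+ 2)%R] < +oo)%E) :
  {ae P, forall w,
    weak_cvg (fun n => spectral_measure (n%:R^-1 *: markov_mx X n w))
             \d_(- m)}.
Proof.
have := ae_cherry_sum_cvg X_iid X_mean X_sq.
have := ae_sqr_sum_cvg m X_iid X_sq.
(* The almost sure event is fixed before the test function [f] is introduced; the rest is
   deterministic. *)
apply: filterS2 => w cA cW f cf bf.
have mf := continuous_measurable_fun cf.
rewrite integral_dirac//; last exact/measurable_EFinP.
rewrite diracT mul1e.
have symA n : (n%:R^-1 *: markov_mx X n w)^T = n%:R^-1 *: markov_mx X n w.
  by rewrite linearZ /= markov_mx_sym.
under eq_fun do rewrite (integral_spectral_measure (symA _) mf).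
apply: cvg_EFin; first exact: nearW.
apply: cvg_mean_bounded => //.
  by move=> n; exact: (size_ordered_spectrum (eigenvals_symmetric (symA n))).
(* The mean squared distance of the spectrum to [-m] is squeezed between 0 and this bound. *)
pose b n := 4 * (sqr_sum (fun i j => X (minn i j) (maxn i j) w - m) n / n%:R ^+ 3)
  + 2 * (cherry_sum (fun i j => X (minn i j) (maxn i j) w - m) n / n%:R ^+ 3)
  + 2 * m ^+ 2 * n%:R^-1.
have b0 : b n @[n --> \oo] --> 0.
  rewrite -[X in _ --> X](_ : 4 * 0 + 2 * 0 + 2 * m ^+ 2 * 0 = 0); last by ring.
  apply: cvgD; first by apply: cvgD; exact: cvgMr.
  by apply: cvgMr; apply/gtr0_cvgV0; [exact: nbhs_infty_gtr|exact: cvgr_idn].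
apply: (@squeeze_cvgr _ _ _ _ (cst 0) b _ _ 0); [|exact: cvg_cst|exact: b0].
near=> n.
have n0 : (0 < n)%N by near: n; exact: nbhs_infty_gt.
rewrite mulr_ge0 ?invr_ge0 ?sumr_ge0//=; last by move=> x _; exact: sqr_ge0.
under eq_bigr do rewrite opprK.
rewrite (spectrum_sqr_dist _ (symA n) (eigenvals_symmetric (symA n)).2).
apply: le_trans (laplacian_sqr_dist (fun i j => X (minn i j) (maxn i j) w) m n0).
(* Unfolding the matrix entries shows that the two sums are equal term by term. *)
rewrite le_eqVlt; apply/orP; left; apply/eqP; congr (_ * _).
apply: eq_bigr => i _; apply: eq_bigr => j _; rewrite !mxE; congr ((_ * (_ - _) + _) ^+ 2).
by congr (_ *+ _); apply: eq_bigr => k _; rewrite mxE.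
Unshelve. all: by end_near.
Qed.
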